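(* Let $f:\mathbb{R}^n\to(-\infty,+\infty]$ be proper, lower semicontinuous and prox-bounded with threshold $\lambda_f>0$, and let $g:\mathbb{R}^n\to\mathbb{R}$ be convex and differentiable with Lipschitz continuous gradient. Suppose $f$ is variationally convex at $\bar x$ for $-\nabla g(\bar x)\in\partial f(\bar x)$. For $\lambda>0$ let $T:=P_\lambda f\circ(\mathrm{Id}-\lambda\nabla g)$. Then $\bar x$ is a local minimizer of $f+g$, and there exists $0<\bar\lambda\le\lambda_f$ such that: (i) for every $\lambda\in(0,\bar\lambda)$ there is a neighborhood $U_\lambda$ of $\bar x$ such that $T$ maps $U_\lambda$ into $U_\lambda$ (single-valuedly), $T$ is averaged on $U_\lambda$, and $T(\bar x)=\bar x$; (ii) for $x_1\in U_\lambda$, the sequence $x_{k+1}:=Tx_k$ converges to some $x^*\in U_\lambda$ satisfying $0\in\nabla g(x^* )+\partial_p^\lambda f(x^* )$; (iii) if in addition $f$ is variationally strongly convex at $\bar x$ for $-\nabla g(\bar x)$, then, after choosing a smaller neighborhood $U_\lambda$, the sequence in (ii) converges linearly to $\bar x$.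
   Context: $P_\lambda f(x):=\operatorname{argmin}_y\{f(y)+\frac1{2\lambda}\|y-x\|^2\}$; $e_\lambda f$ the corresponding infimal value. Prox-bounded with threshold $\lambda_f$: $\lambda_f=\sup\{\lambda>0: e_\lambda f(x)>-\infty\text{ for some }x\}>0$. $v\in\partial_p^\lambda f(x)$ iff $x\in\operatorname{dom}f$ and $f(y)\ge f(x)+\langle v,y-x\rangle-\frac1{2\lambda}\|y-x\|^2$ for all $y$. $\partial f$ is the limiting subdifferential. Variational convexity of $f$ at $\bar x$ for $\bar v\in\partial f(\bar x)$: for some convex neighborhood $U\times V$ of $(\bar x,\bar v)$ there are a lsc convex $\varphi\le f$ on $U$ and $\varepsilon>0$ with $[U_\varepsilon\times V]\cap\operatorname{gph}\partial f=[U\times V]\cap\operatorname{gph}\partial\varphi$ and $f=\varphi$ at common elements, $U_\varepsilon=\{x\in U:f(x)<f(\bar x)+\varepsilon\}$; variational strong convexity is the same with $\varphi$ strongly convex (with some modulus $\sigma>0$). $T$ averaged on $U$: $T=(1-\alpha)\mathrm{Id}+\alpha N$ for some $\alpha\in(0,1)$ and $N$ nonexpansive on $U$. *)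

(* Defs.v *)
From HB Require Import structures.
From mathcomp Require Import all_boot all_order all_algebra.
From mathcomp Require Import all_classical all_reals all_analysis.
Set Implicit Arguments. Unset Strict Implicit. Unset Printing Implicit Defensive.
Import Order.TTheory GRing.Theory Num.Theory.
Import numFieldNormedType.Exports.
Local Open Scope classical_set_scope.
Local Open Scope ring_scope.

Section Defs.
Variables (R : realType) (n : nat).
Notation vec := 'rV[R]_n.

Definition dotv (x y : vec) : R := \sum_(i < n) x ord0 i * y ord0 i.
Definition enorm (x : vec) : R := Num.sqrt (dotv x x).

Definition convex_set (A : set vec) : Prop :=
  forall x y t, A x -> A y -> 0 <= t <= 1 -> A ((1 - t) *: x + t *: y).

Definition proper_fun (f : vec -> \bar R) : Prop :=
  (forall x, f x != -oo%E) /\ (exists x, f x \is a fin_num).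

Definition lsc (f : vec -> \bar R) : Prop :=
  forall x (a : R), (a%:E < f x)%E -> \forall y \near x, (a%:E < f y)%E.

Definition convex_efun (phi : vec -> \bar R) : Prop :=
  forall x y : vec, forall t : R, 0 < t < 1 ->
    (phi ((1 - t) *: x + t *: y)%R <= (1 - t)%:E * phi x + t%:E * phi y)%E.

Definition strongly_convex_efun (sigma : R) (phi : vec -> \bar R) : Prop :=
  forall x y : vec, forall t : R, 0 < t < 1 ->
    (phi ((1 - t) *: x + t *: y)%R <= (1 - t)%:E * phi x + t%:E * phi y
       - (sigma / 2 * t * (1 - t) * enorm (x - y) ^+ 2)%:E)%E.

Definition moreau_env (f : vec -> \bar R) (lam : R) (x : vec) : \bar R :=
  ereal_inf [set (f y + (enorm (y - x) ^+ 2 / (2 * lam))%:E)%E | y in [set: vec]].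

Definition prox (f : vec -> \bar R) (lam : R) (x : vec) : set vec :=
  [set y | forall z, (f y + (enorm (y - x) ^+ 2 / (2 * lam))%:E
                       <= f z + (enorm (z - x) ^+ 2 / (2 * lam))%:E)%E].

Definition prox_bounded (f : vec -> \bar R) : Prop :=
  exists lam : R, 0 < lam /\ exists x, (-oo < moreau_env f lam x)%E.

Definition prox_threshold (f : vec -> \bar R) : \bar R :=
  ereal_sup [set lam%:E | lam in
     [set lam : R | 0 < lam /\ exists x, (-oo < moreau_env f lam x)%E]].

Definition regular_subdiff (f : vec -> \bar R) (x v : vec) : Prop :=
  f x \is a fin_num /\
  forall eps : R, 0 < eps -> \forall y \near x,
     (f x + (dotv v (y - x) - eps * enorm (y - x))%:E <= f y)%E.

Definition lim_subdiff (f : vec -> \bar R) (x v : vec) : Prop :=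
  f x \is a fin_num /\
  exists (xk vk : nat -> vec),
    [/\ xk @ \oo --> x, (fun k => f (xk k)) @ \oo --> f x,
        vk @ \oo --> v & forall k, regular_subdiff f (xk k) (vk k)].

Definition prox_subdiff (lam : R) (f : vec -> \bar R) (x v : vec) : Prop :=
  f x \is a fin_num /\
  forall y, (f x + (dotv v (y - x) - enorm (y - x) ^+ 2 / (2 * lam))%:E <= f y)%E.

Definition var_convex_gen (cvx : (vec -> \bar R) -> Prop)
    (f : vec -> \bar R) (xbar vbar : vec) : Prop :=
  lim_subdiff f xbar vbar /\
  exists (U V : set vec) (phi : vec -> \bar R) (eps : R),
    [/\ (nbhs xbar U /\ convex_set U), (nbhs vbar V /\ convex_set V),
        (lsc phi /\ cvx phi /\ forall x, U x -> (phi x <= f x)%E),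
        0 < eps &
        forall x v, V v ->
          ((U x /\ (f x < f xbar + eps%:E)%E /\ lim_subdiff f x v)
             <-> (U x /\ lim_subdiff phi x v)) /\
          (U x /\ (f x < f xbar + eps%:E)%E /\ lim_subdiff f x v -> f x = phi x)].

Definition var_convex := var_convex_gen convex_efun.
Definition var_strongly_convex (f : vec -> \bar R) (xbar vbar : vec) : Prop :=
  exists sigma : R, 0 < sigma /\ var_convex_gen (strongly_convex_efun sigma) f xbar vbar.

Definition convex_rfun (g : vec -> R) : Prop :=
  forall x y (t : R), 0 <= t <= 1 ->
    g ((1 - t) *: x + t *: y) <= (1 - t) * g x + t * g y.

Definition is_gradient (g : vec -> R) (G : vec -> vec) : Prop :=
  forall x, differentiable g x /\ forall h, 'd g x h = dotv (G x) h.

Definition lipschitz_map (G : vec -> vec) : Prop :=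
  exists L : R, 0 <= L /\ forall x y, enorm (G x - G y) <= L * enorm (x - y).

Definition nonexpansive_on (U : set vec) (N : vec -> vec) : Prop :=
  forall x y, U x -> U y -> enorm (N x - N y) <= enorm (x - y).

Definition averaged_on (U : set vec) (T : vec -> vec) : Prop :=
  exists (alpha : R) (N : vec -> vec),
    [/\ 0 < alpha < 1, nonexpansive_on U N &
        forall x, U x -> T x = (1 - alpha) *: x + alpha *: N x].

(* Picard iteration x_1 = x1, x_{k+1} = T x_k (indexed from 0) *)
Definition iter_seq (T : vec -> vec) (x1 : vec) (k : nat) : vec := iter k T x1.

Definition converges_linearly (u : nat -> vec) (xbar : vec) : Prop :=
  exists q : R, 0 <= q < 1 /\
    forall k, enorm (u k.+1 - xbar) <= q * enorm (u k - xbar).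

End Defs.

(* Main.v *)
Require Import Defs.
From HB Require Import structures.
From mathcomp Require Import all_boot all_order all_algebra.
From mathcomp Require Import all_classical all_reals all_analysis.
From mathcomp Require Import ring lra.
Set Implicit Arguments.
Unset Strict Implicit.
Unset Printing Implicit Defensive.

Import Order.TTheory GRing.Theory Num.Theory.
Import numFieldNormedType.Exports.
Local Open Scope classical_set_scope.
Local Open Scope ring_scope.

(** Near [xbar] every proximal point [y] of [x] satisfies [(x - y) / lam \in \partial f y] with
    [y] close to [xbar], [f y] close to [f xbar] and [(x - y) / lam] close to [- G xbar]; these
    three properties follow quantitatively from a global quadratic minorant of [f] that touches
    [f] at [xbar].  Variational convexity then places [(y, (x - y) / lam)] in the graph of the
    monotone map [\partial phi], so the proximal map is single-valued and firmly nonexpansive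
    there.  Composed with the gradient step, which is nonexpansive because [G] is cocoercive, it
    gives an averaged map fixing [xbar], whose iterates converge by the Krasnoselskii-Mann
    argument.  Strong convexity of [phi] makes the same map a contraction towards [xbar]. *)

(** * The Euclidean norm and its agreement with the ambient topology *)

Section EuclideanNorm.
Context {R : realType} {n : nat}.
Implicit Types x y z : 'rV[R]_n.

Lemma dotvC x y : dotv x y = dotv y x.
Proof. by apply: eq_bigr => i _; rewrite mulrC. Qed.

Lemma dotvDl x y z : dotv (x + y) z = dotv x z + dotv y z.
Proof. by rewrite -big_split; apply: eq_bigr => i _; rewrite mxE mulrDl. Qed.

Lemma dotvZl (a : R) x y : dotv (a *: x) y = a * dotv x y.
Proof. by rewrite mulr_sumr; apply: eq_bigr => i _; rewrite mxE mulrA. Qed.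

Lemma dotvNl x y : dotv (- x) y = - dotv x y.
Proof. by rewrite -scaleN1r dotvZl mulN1r. Qed.

Lemma dotvDr x y z : dotv x (y + z) = dotv x y + dotv x z.
Proof. by rewrite dotvC dotvDl !(dotvC x). Qed.

Lemma dotvZr (a : R) x y : dotv x (a *: y) = a * dotv x y.
Proof. by rewrite dotvC dotvZl dotvC. Qed.

Lemma dotvNr x y : dotv x (- y) = - dotv x y.
Proof. by rewrite dotvC dotvNl dotvC. Qed.

Lemma dotv0l x : dotv 0 x = 0.
Proof. by rewrite -(scale0r 0) dotvZl mul0r. Qed.

Lemma dotvv_ge0 x : 0 <= dotv x x.
Proof. by apply: sumr_ge0 => i _; rewrite -expr2 sqr_ge0. Qed.

Lemma dotvv_eq0 x : dotv x x = 0 -> x = 0.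
Proof.
move/eqP; rewrite psumr_eq0; last by move=> i _; rewrite -expr2 sqr_ge0.
move=> /allP h; apply/rowP => i; rewrite mxE.
by have := h i (mem_index_enum _); rewrite mulf_eq0 orbb => /eqP.
Qed.

Lemma enorm_ge0 x : 0 <= enorm x.
Proof. exact: sqrtr_ge0. Qed.

Lemma enorm_sq x : enorm x ^+ 2 = dotv x x.
Proof. by rewrite sqr_sqrtr // dotvv_ge0. Qed.

Lemma enorm0 : enorm (0 : 'rV[R]_n) = 0.
Proof. by rewrite /enorm dotv0l sqrtr0. Qed.

Lemma enorm_eq0 x : enorm x = 0 -> x = 0.
Proof. by move=> h; apply: dotvv_eq0; rewrite -enorm_sq h expr0n. Qed.

Lemma enormN x : enorm (- x) = enorm x.
Proof. by rewrite /enorm dotvNl dotvNr opprK. Qed.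

Lemma enormB x y : enorm (x - y) = enorm (y - x).
Proof. by rewrite -enormN opprB. Qed.

Lemma enormZ (a : R) x : enorm (a *: x) = `|a| * enorm x.
Proof.
by rewrite /enorm dotvZl dotvZr mulrA -expr2 sqrtrM ?sqr_ge0 // sqrtr_sqr.
Qed.

(** Cauchy-Schwarz: the squared norm of [enorm y *: x - enorm x *: y] is nonnegative and expands to
    twice [enorm x * enorm y] times the difference of the two sides. *)
Lemma dotv_enorm x y : dotv x y <= enorm x * enorm y.
Proof.
have [a0 b0] := (enorm_ge0 x, enorm_ge0 y).
have [/enorm_eq0 ->|a1] := eqVneq (enorm x) 0.
  by rewrite dotv0l enorm0 mul0r.
have [/enorm_eq0 ->|b1] := eqVneq (enorm y) 0.
  by rewrite dotvC dotv0l enorm0 mulr0.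
have ab : 0 < enorm x * enorm y by rewrite mulr_gt0 // lt_neqAle eq_sym ?a1 ?b1.
have := dotvv_ge0 (enorm y *: x - enorm x *: y).
rewrite !(dotvDl, dotvDr, dotvNl, dotvNr, dotvZl, dotvZr) (dotvC y x).
rewrite -!enorm_sq => h.
have {}h : 0 <= (enorm x * enorm y) * (enorm x * enorm y - dotv x y) by nra.
by rewrite pmulr_rge0 // subr_ge0 in h.
Qed.

Lemma enorm_triangle x y : enorm (x + y) <= enorm x + enorm y.
Proof.
rewrite -(@ler_pXn2r _ 2) ?nnegrE ?addr_ge0 ?enorm_ge0 //.
rewrite enorm_sq !(dotvDl, dotvDr) (dotvC y x) -!enorm_sq.
by have := dotv_enorm x y; lra.
Qed.

Lemma coord_le_enorm x i : `|x ord0 i| <= enorm x.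
Proof.
rewrite -(@ler_pXn2r _ 2) ?nnegrE ?enorm_ge0 // enorm_sq real_normK ?num_real //.
rewrite /dotv (bigD1 i) //= -expr2 lerDl.
by apply: sumr_ge0 => j _; rewrite -expr2 sqr_ge0.
Qed.

Lemma norm_le_enorm x : `|x| <= enorm x.
Proof.
rewrite [`|x|]mx_normrE; apply/bigmax_leP; split; first exact: enorm_ge0.
by move=> [i j] _ /=; rewrite (ord1 i); apply: coord_le_enorm.
Qed.

Lemma coord_le_norm x i : `|x ord0 i| <= `|x|.
Proof.
by rewrite [`|x|]mx_normrE; apply/bigmax_geP; right => /=; exists (ord0, i).
Qed.

Lemma enorm_le_norm x : enorm x <= Num.sqrt n%:R * `|x|.
Proof.
rewrite -(@ler_pXn2r _ 2) ?nnegrE ?enorm_ge0 ?mulr_ge0 ?sqrtr_ge0 //.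
rewrite enorm_sq exprMn sqr_sqrtr ?ler0n // mulr_natl.
rewrite -[X in _ *+ X](card_ord n) -sumr_const /dotv.
apply: ler_sum => i _; rewrite -expr2 -real_normK ?num_real //.
by rewrite ler_pXn2r ?nnegrE // coord_le_norm.
Qed.

(** The topology on row vectors comes from the max norm; the bounds [norm_le_enorm] and
    [enorm_le_norm] make the Euclidean balls a neighborhood base as well. *)
Lemma nbhs_enormP x (U : set 'rV[R]_n) :
  nbhs x U <-> exists2 r, 0 < r & forall y, enorm (y - x) < r -> U y.
Proof.
split=> [/nbhs_ballP[r /= r0 h]|[r r0 h]].
  exists r => // y yx; apply: h; rewrite -ball_normE /ball_ /=.
  by rewrite distrC; apply: le_lt_trans (norm_le_enorm _) yx.
(* The [+ 1] keeps the denominator positive when [n = 0]. *)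
apply/nbhs_ballP; exists (r / (Num.sqrt n%:R + 1)) => /=.
  by rewrite divr_gt0 // ltr_wpDl ?sqrtr_ge0.
move=> y; rewrite -ball_normE /ball_ /= distrC => yx; apply: h.
have s0 : 0 <= Num.sqrt n%:R :> R by exact: sqrtr_ge0.
rewrite ltr_pdivlMr ?ltr_wpDl // in yx.
apply: le_lt_trans (enorm_le_norm _) _; apply: le_lt_trans yx.
by rewrite mulrC ler_wpM2l // lerDl.
Qed.

Lemma nbhs_enorm_ball x r : 0 < r -> nbhs x [set y | enorm (y - x) <= r].
Proof. by move=> r0; apply/nbhs_enormP; exists r => // y /ltW. Qed.

Lemma cvg_enormP (u : nat -> 'rV[R]_n) x :
  u @ \oo --> x <->
  forall e, 0 < e -> \forall k \near \oo, enorm (u k - x) < e.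
Proof.
split=> [h e e0|h U /nbhs_enormP[r r0 rU]].
  by apply: (h [set y | enorm (y - x) < e]); apply/nbhs_enormP; exists e.
by rewrite nbhs_filterE; near=> k; apply: rU; near: k; exact: h.
Unshelve. all: by end_near. Qed.

Lemma cvg_dotv (T : Type) (F : set_system T) {FF : Filter F}
    (u v : T -> 'rV[R]_n) x y :
  u @ F --> x -> v @ F --> y -> (fun k => dotv (u k) (v k)) @ F --> dotv x y.
Proof.
move=> ux vy; apply: cvg_big => [|i _]; first exact: add_continuous.
apply: cvgM.
  by apply: (@continuous_cvg _ 'rV[R]_n R _ _ _ (fun M => M ord0 i)) => //; exact: coord_continuous.
by apply: (@continuous_cvg _ 'rV[R]_n R _ _ _ (fun M => M ord0 i)) => //; exact: coord_continuous.
Qed.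

Lemma compact_enorm_ball x r : compact [set y | enorm (y - x) <= r].
Proof.
apply: bounded_closed_compact.
  exists (`|x| + r); split; first exact: num_real.
  move=> M /ltW rM y /= yx; apply: le_trans rM.
  rewrite -[y in `|y|](subrK x) addrC; apply: le_trans (ler_normD _ _) _.
  by rewrite lerD2l; apply: le_trans yx; exact: norm_le_enorm.
rewrite closedE => y /= h; apply/ler_addgt0Pr => e e0.
apply: contrapT => /negP; rewrite -ltNge => hy; apply: h.
apply/nbhs_enormP; exists e => // z zy /=.
have := enorm_triangle (y - z) (z - x).
rewrite addrA subrK enormB; lra.
Qed.

(** The sublevel sets above the infimum [m] generate a proper filter on [A], which has a cluster
    point [p] by compactness. If [m < F p], take a real [a] strictly between: near [p] one has
    [a < F], yet this neighborhood must meet the sublevel set of [a]. *)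
Lemma lsc_compact_min (A : set 'rV[R]_n) (F : 'rV[R]_n -> \bar R) :
  compact A -> A !=set0 -> lsc F -> exists2 y, A y & forall z, A z -> (F y <= F z)%E.
Proof.
move=> cA [x0 Ax0] lF; pose m := ereal_inf (F @` A).
have [moo|moo] := eqVneq m +oo%E.
  exists x0 => // z Az.
  have : (m <= F z)%E by apply: ereal_inf_lbound; exists z.
  by rewrite moo leye_eq => /eqP ->; rewrite leey.
pose S (a : \bar R) := [set x | A x /\ (F x < a)%E].
pose FF := filter_from [set a | (m < a)%E] S.
have S0 a : (m < a)%E -> S a !=set0.
  move=> ma; have [_ [y Ay <-] ya] := ereal_inf_lt ma.
  by exists y; split.
have PF : ProperFilter FF.
  apply: filter_from_proper; last by move=> a /S0.
  apply: filter_from_filter; first by exists +oo%E; rewrite /= ltey.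
  move=> a b /= ma mb; exists (Order.min a b); first by rewrite /= lt_min ma mb.
  by move=> y [Ay]; rewrite lt_min => /andP[ya yb].
have [p [Ap Cp]] : A `&` cluster FF !=set0.
  apply: cA; exists +oo%E; first by rewrite /= ltey.
  by move=> y [].
exists p => // z Az.
suff pm : (F p <= m)%E by apply: le_trans pm _; apply: ereal_inf_lbound; exists z.
rewrite leNgt; apply/negP => mp.
have [a ma ap] : exists2 a : R, (m < a%:E)%E & (a%:E < F p)%E.
  move: moo mp; case: (m) => [m'| |] // _; case: (F p) => [p'| |] //.
  - by rewrite lte_fin => mp; exists ((m' + p') / 2); rewrite lte_fin; lra.
  - by exists (m' + 1); rewrite ?ltry ?lte_fin //; lra.
  - by exists (p' - 1); rewrite ?ltNyr ?lte_fin //; lra.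
  - by exists 0; rewrite ?ltNyr ?ltry.
have [] := Cp (S a%:E) [set y | (a%:E < F y)%E].
- by exists a%:E.
- exact: lF.
by move=> y [[_ ya]] /= /(lt_trans ya); rewrite ltxx.
Qed.

End EuclideanNorm.

(** * Global subgradient inequalities for convex and strongly convex functions *)

Section ConvexSubgradients.
Context {R : realType} {n : nat}.
Implicit Types (phi : 'rV[R]_n -> \bar R) (sigma : R).

Lemma convex_strongly_convex0 phi : convex_efun phi -> strongly_convex_efun 0 phi.
Proof. by move=> cphi x y t t01; rewrite !mul0r sube0; apply: cphi. Qed.

(** For [sigma = 0] this is the subgradient inequality of convex analysis, so one argument serves
    both the convex and the strongly convex case. *)
Definition strong_subgrad sigma phi (x v : 'rV[R]_n) :=
  phi x \is a fin_num /\ forall y,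
    (phi x + (dotv v (y - x) + sigma / 2 * enorm (y - x) ^+ 2)%:E <= phi y)%E.

(** The local inequality is applied at a point at parameter [t] on the segment from [x] to [y],
    strong convexity bounds [phi] there from above, and dividing by [t] leaves an arbitrarily small
    error. *)
Lemma regular_strong_subgrad sigma phi x v : 0 <= sigma ->
  strongly_convex_efun sigma phi -> regular_subdiff phi x v ->
  strong_subgrad sigma phi x v.
Proof.
move=> s0 cphi [fx rx]; split => // y.
move: fx cphi rx; case E : (phi x) => [a| |] // _ cphi rx.
pose c := enorm (y - x); have c0 : 0 <= c := enorm_ge0 _.
have key e : 0 < e -> exists t : R, [/\ 0 < t < 1, sigma / 2 * t * c ^+ 2 <= e &
    ((a + t * dotv v (y - x) - e * t)%:E <= (1 - t)%:E * a%:E + t%:E * phi y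
      - (sigma / 2 * t * (1 - t) * c ^+ 2)%:E)%E].
  move=> e0; have c1 : 0 < c + 1 by rewrite ltr_wpDl.
  have /nbhs_enormP[r r0 hr] := rx _ (divr_gt0 e0 c1).
  have d0 : 0 < sigma * c ^+ 2 + 1 by rewrite ltr_wpDl // mulr_ge0 ?sqr_ge0.
  (* The three bounds keep [t] inside (0, 1), the segment point inside the ball of radius [r], and
     the loss in the quadratic term below [e]. The added ones avoid division by zero. *)
  pose t := Num.min 2^-1 (Num.min (r / (c + 1)) (e / (sigma * c ^+ 2 + 1))).
  have t0 : 0 < t by rewrite !lt_min invr_gt0 ltr0n !divr_gt0.
  have t2 : t <= 2^-1 by rewrite ge_min lexx.
  have tr : t * (c + 1) <= r by rewrite -ler_pdivlMr // !ge_min lexx orbT.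
  have te : t * (sigma * c ^+ 2 + 1) <= e.
    by rewrite -ler_pdivlMr // !ge_min lexx !orbT.
  have t1 : 0 < t < 1 by rewrite t0 /=; lra.
  exists t; split => //; first by nra.
  have zx : (1 - t) *: x + t *: y - x = t *: (y - x).
    by rewrite scalerBl scale1r scalerBr addrC addrA addrA addNr add0r addrC.
  have := hr ((1 - t) *: x + t *: y).
  rewrite zx enormZ gtr0_norm // dotvZr -/c => /(_ _) h1.
  have {h1} : (a%:E + (t * dotv v (y - x) - e / (c + 1) * (t * c))%:E
               <= phi ((1 - t) *: x + t *: y)%R)%E by apply: h1; nra.
  move=> h1; have := le_trans h1 (cphi x y t t1).
  rewrite E enormB -/c; apply: le_trans.
  rewrite -EFinD lee_fin addrA lerD2l lerN2 mulrCA.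
  rewrite [leRHS]mulrC ler_pM2l // mulrAC ler_pdivrMr // ler_pM2l //.
  lra.
case Ey : (phi y) key => [b| |] key.
- rewrite -EFinD lee_fin; apply/ler_addgt0Pr => e e0.
  have [t [/andP[t0 t1] h1]] := key (e / 2) ltac:(lra).
  rewrite -!EFinM -!EFinD lee_fin -/c => h2.
  have : t * (a + (dotv v (y - x) + sigma / 2 * c ^+ 2)) <= t * (b + e) by nra.
  by rewrite ler_pM2l.
- by rewrite leey.
- have [t [/andP[t0 t1] _]] := key 1 ltr01.
  by rewrite gt0_muleNy ?lte_fin // addeNy addNye.
Qed.

(** The inequality holds along the approximating sequence and passes to the limit, because the
    values [phi (xk k)] converge to [phi x]. *)
Lemma lim_strong_subgrad sigma phi x v : 0 <= sigma ->
  strongly_convex_efun sigma phi -> lim_subdiff phi x v ->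
  strong_subgrad sigma phi x v.
Proof.
move=> s0 cphi [fx [xk [vk [xkx fkf vkv reg]]]]; split => // y.
have sub k := regular_strong_subgrad s0 cphi (reg k).
have fkr : (fun k => fine (phi (xk k))) @ \oo --> fine (phi x).
  by apply: fine_cvg; rewrite fineK.
have wk : (fun k => y - xk k) @ \oo --> y - x by apply: cvgB => //; exact: cvg_cst.
case Ey : (phi y) => [b| |]; last 2 first.
- by rewrite leey.
- have [f0 /(_ y)] := sub 0%N; rewrite Ey.
  by move: f0; case: (phi (xk 0%N)).
rewrite -(fineK fx) -EFinD lee_fin.
have lim : (fun k => fine (phi (xk k)) + (dotv (vk k) (y - xk k) +
    sigma / 2 * dotv (y - xk k) (y - xk k))) @ \oo -->
    fine (phi x) + (dotv v (y - x) + sigma / 2 * dotv (y - x) (y - x)).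
  apply: cvgD => //; apply: cvgD; first exact: cvg_dotv.
  by apply: cvgM; [exact: cvg_cst | exact: cvg_dotv].
rewrite enorm_sq; apply: (cvgr_to_le lim); near=> k.
have [f0 /(_ y)] := sub k.
by rewrite Ey -(fineK f0) -EFinD lee_fin -enorm_sq.
Unshelve. all: by end_near. Qed.

Lemma strong_subgrad_monotone sigma phi x1 v1 x2 v2 :
  strong_subgrad sigma phi x1 v1 -> strong_subgrad sigma phi x2 v2 ->
  sigma * enorm (x1 - x2) ^+ 2 <= dotv (v1 - v2) (x1 - x2).
Proof.
move=> [f1 /(_ x2) h1] [f2 /(_ x1) h2]; move: h1 h2.
rewrite -(fineK f1) -(fineK f2) -!EFinD !lee_fin -(enormB x1 x2).
rewrite !(dotvDl, dotvDr, dotvNl, dotvNr); lra.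
Qed.

End ConvexSubgradients.

(** * Cocoercivity of the gradient of a smooth convex function *)

Section ConvexGradient.
Context {R : realType} {n : nat}.
Variables (g : 'rV[R]_n -> R) (G : 'rV[R]_n -> 'rV[R]_n).
Hypotheses (cg : convex_rfun g) (dg : is_gradient g G).

(** The directional derivative is within [e] of a difference quotient along the segment, and
    convexity bounds that quotient by [g y - g x]. *)
Lemma gradient_ineq x y : g x + dotv (G x) (y - x) <= g y.
Proof.
have [dgx dgE] := dg x; rewrite -dgE -deriveE //.
have /cvgrPdist_le dv : derivable g x (y - x) by exact: diff_derivable.
apply/ler_addgt0Pr => e e0.
have /= [r /= r0 hr] := dv _ e0.
pose t := Num.min 2^-1 (r / 2).
have t0 : 0 < t by rewrite lt_min invr_gt0 ltr0n divr_gt0.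
have t2 : t <= 2^-1 by rewrite ge_min lexx.
have tr : t <= r / 2 by rewrite ge_min lexx orbT.
have := hr t; rewrite /ball_ /= sub0r normrN gtr0_norm // => /(_ _ _)/wrap[].
- lra.
- by rewrite gt_eqF.
have zx : t *: (y - x) + x = (1 - t) *: x + t *: y.
  by rewrite scalerBl scale1r scalerBr addrC addrA addrAC.
rewrite /shift /= zx ler_norml /derive => /andP[_].
have t01 : 0 <= t <= 1 by lra.
have := cg x y t01.
set gz := g _; set D := lim _ => h1 h2.
have : t * D <= t * (g y - g x + e).
  have : t * (D - t^-1 * (gz - g x)) <= t * e by rewrite ler_pM2l.
  rewrite mulrBr mulrA divff ?gt_eqF // mul1r; lra.
rewrite ler_pM2l //; lra.
Qed.

Hypothesis L : R.
Hypotheses (L0 : 0 < L) (lipG : forall x y, enorm (G x - G y) <= L * enorm (x - y)).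

(* The sharp constant [L / 2] would need an integral; convexity alone gives [L]. *)
Lemma descent_ineq x y : g y <= g x + dotv (G x) (y - x) + L * enorm (y - x) ^+ 2.
Proof.
have := gradient_ineq y x.
have : dotv (G y - G x) (y - x) <= L * enorm (y - x) ^+ 2.
  apply: le_trans (dotv_enorm _ _) _; rewrite expr2 mulrA.
  by rewrite ler_wpM2r ?enorm_ge0.
rewrite !(dotvDl, dotvDr, dotvNl, dotvNr); lra.
Qed.

(** Baillon-Haddad argument: [half] sharpens the gradient inequality by a quadratic term, and adding
    it to its copy with the points exchanged cancels the values of [g]. The factor [2 * L] reflects
    the constant [L] in [descent_ineq]. *)
Lemma gradient_cocoercive x y :
  dotv (G x - G y) (G x - G y) <= 2 * L * dotv (G x - G y) (x - y).
Proof.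
suff half u w : g u - g w + dotv (G u) (w - u) <=
    - (4 * L)^-1 * dotv (G w - G u) (G w - G u).
  have := lerD (half x y) (half y x).
  rewrite -(opprB (G x) (G y)) dotvNl dotvNr opprK => h.
  have L4 : 0 < 4 * L by rewrite mulr_gt0.
  have i0 : 0 < (4 * L)^-1 by rewrite invr_gt0.
  have e : (4 * L)^-1 * (4 * L) = 1 by rewrite mulVf // gt_eqF.
  have : 2 * (4 * L)^-1 * dotv (G x - G y) (G x - G y) <= dotv (G x - G y) (x - y).
    by move: h; rewrite !(dotvDl, dotvDr, dotvNl, dotvNr); lra.
  move=> /(ler_wpM2l (ltW L4)); set P := dotv _ _; set i := _^-1.
  have -> : 4 * L * (2 * i * P) = 2 * (i * (4 * L)) * P by ring.
  by rewrite e; lra.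
pose D := G w - G u; pose c := (2 * L)^-1.
have c0 : 0 < c by rewrite invr_gt0 mulr_gt0.
have cL : c * L = 2^-1 by rewrite /c; field; rewrite gt_eqF.
have -> : (4 * L)^-1 = c / 2 by rewrite /c; field; rewrite gt_eqF.
(* This point minimizes the descent bound at [w] minus the linear form of [G u]; that difference is
   compared with the gradient inequality at [u]. *)
pose z := w - c *: D.
have := descent_ineq w z; have := gradient_ineq u z.
rewrite enorm_sq.
have -> : z - w = - (c *: D) by rewrite /z addrAC subrr add0r.
have -> : z - u = (w - u) - c *: D by rewrite /z addrAC.
rewrite [dotv (- _) _]dotvNl !dotvNr opprK dotvZl !dotvZr [dotv (G u) (_ - _)]dotvDr.
rewrite dotvNr dotvZr.
have : dotv (G w) D - dotv (G u) D = dotv D D by rewrite [RHS]dotvDl dotvNl.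
rewrite -/D => hD h1 h2.
have e1 : L * (c * (c * dotv D D)) = c * dotv D D / 2.
  by rewrite -[RHS]mulrC -cL; ring.
have e2 : c * dotv (G w) D - c * dotv (G u) D = c * dotv D D by rewrite -mulrBr hD.
lra.
Qed.

End ConvexGradient.

(** * Proximal points as subgradients, and a global quadratic minorant *)

Section ProxSubgradients.
Context {R : realType} {n : nat}.
Implicit Types (f phi : 'rV[R]_n -> \bar R) (lam sigma : R).

Lemma prox_fin_num f lam x y : proper_fun f -> prox f lam x y -> f y \is a fin_num.
Proof.
move=> [fN [z fz]] /(_ z).
by have := fN y; move: fz; case: (f z) => // c; case: (f y).
Qed.

(** Expanding the square of [z - x] about [y] turns minimality of [y] into the proximal subgradient
    inequality. *)
Lemma prox_prox_subdiff f lam x y : proper_fun f -> 0 < lam ->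
  prox f lam x y -> prox_subdiff lam f y (lam^-1 *: (x - y)).
Proof.
move=> pf l0 px; have fy := prox_fin_num pf px; split => // z.
have fN := pf.1 z; have := px z; move: fN; rewrite -(fineK fy).
case: (f z) => [c| |] // _ h; last by rewrite leey.
rewrite -!EFinD !lee_fin in h *.
have e : enorm (z - x) ^+ 2 / (2 * lam) = enorm (z - y) ^+ 2 / (2 * lam)
    - dotv (lam^-1 *: (x - y)) (z - y) + enorm (y - x) ^+ 2 / (2 * lam).
  rewrite !enorm_sq !(dotvDl, dotvDr, dotvNl, dotvNr, dotvZl).
  rewrite (dotvC z x) (dotvC z y) (dotvC y x); field; rewrite gt_eqF //.
by rewrite e in h; lra.
Qed.

Lemma prox_subdiff_lim_subdiff f lam x v : 0 < lam ->
  prox_subdiff lam f x v -> lim_subdiff f x v.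
Proof.
move=> l0 [fx h]; split => //; exists (fun=> x), (fun=> v).
split; [exact: cvg_cst|exact: cvg_cst|exact: cvg_cst|move=> _].
(* Within radius [2 * lam * e] the quadratic term is at most [e] times the distance. *)
split => // e e0; apply/nbhs_enormP; exists (2 * lam * e).
  by rewrite !mulr_gt0.
move=> y yx; apply: le_trans (h y).
rewrite leeD2lE // lee_fin lerD2l lerN2 ler_pdivrMr ?mulr_gt0 //.
by have := ler_wpM2l (enorm_ge0 (y - x)) (ltW yx); lra.
Qed.

Lemma lscD_sqnorm f lam x : (forall y, f y != -oo%E) -> lsc f ->
  lsc (fun y => f y + (enorm (y - x) ^+ 2 / (2 * lam))%:E)%E.
Proof.
move=> fN lf y0 a; pose q (y : 'rV[R]_n) := enorm (y - x) ^+ 2 / (2 * lam).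
rewrite -/(q y0) => ay.
have cq (F : set_system 'rV[R]_n) : Filter F -> id @ F --> y0 -> q @ F --> q y0.
  move=> FF Fy; rewrite /q enorm_sq; under eq_fun do rewrite enorm_sq.
  apply: cvgM; last exact: cvg_cst.
  by apply: cvg_dotv; apply: cvgB => //; exact: cvg_cst.
have [b [e [bf e0 abe]]] : exists b e : R,
    [/\ (b%:E < f y0)%E, 0 < e & a <= b + (q y0 - e)].
  move: ay (fN y0); case: (f y0) => [c| |] // ay _.
  - rewrite -EFinD lte_fin in ay.
    exists (c - (c + q y0 - a) / 2), ((c + q y0 - a) / 2).
    by split; rewrite ?lte_fin; lra.
  - exists (a - q y0 + 1), 1; split; rewrite ?ltry //; lra.
have q1 : q y0 - e < q y0 by lra.
near=> y; have fy : (b%:E < f y)%E by near: y; apply: lf.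
have qy : q y0 - e < q y.
  by near: y; exact: (cvgr_gt (q y0) (cq _ (nbhs_filter y0) (@cvg_id _ _)) _ q1).
rewrite -/(q y); case: (f y) fy => [c| |] // fy.
  by rewrite -EFinD !lte_fin in fy *; lra.
by rewrite addye // ltry.
Unshelve. all: by end_near. Qed.

(** Inside the ball the affine minorant suffices. Outside it, prox-boundedness bounds [f] below by a
    quadratic centered at [x1], and constant and linear terms are absorbed because the distance to
    [xbar] is at least [r]. *)
Lemma quadratic_minorant f lam x1 xbar v r :
  0 < lam -> (-oo < moreau_env f lam x1)%E -> f xbar \is a fin_num -> 0 < r ->
  (forall y, enorm (y - xbar) < r -> (f xbar + (dotv v (y - xbar))%:E <= f y)%E) ->
  exists2 K, 0 < K & forall y,
    (f xbar + (dotv v (y - xbar) - K * enorm (y - xbar) ^+ 2)%:E <= f y)%E.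
Proof.
move=> l0 env fx r0 hr; rewrite -(fineK fx) in hr *; set a := fine _ in hr *.
have [M hM] : exists M : R, forall y,
    (M%:E <= f y + (enorm (y - x1) ^+ 2 / (2 * lam))%:E)%E.
  have lb y : (moreau_env f lam x1 <= f y + (enorm (y - x1) ^+ 2 / (2 * lam))%:E)%E.
    by apply: ereal_inf_lbound; exists y.
  case: (moreau_env f lam x1) env lb => [m| |] // _ lb; first by exists m.
  by exists 0 => y; apply: le_trans (lb y); rewrite leey.
pose c : R := `|a - M + enorm (xbar - x1) ^+ 2 / lam|.
have i0 : 0 < lam^-1 by rewrite invr_gt0.
have s0 : 0 < r^-1 by rewrite invr_gt0.
have v0 := enorm_ge0 v.
have c0 : 0 <= c by exact: normr_ge0.
have cs : 0 <= c * r^-1 ^+ 2 by rewrite mulr_ge0 // sqr_ge0.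
have vs : 0 <= enorm v * r^-1 by rewrite mulr_ge0 // ltW.
(* The summands absorb, in order, the constant, the linear term and the quadratic term recentered
   from [x1] to [xbar]. *)
exists (c * r^-1 ^+ 2 + enorm v * r^-1 + lam^-1); first lra.
move=> y; set K := _ + lam^-1; have K0 : 0 < K by rewrite /K; lra.
have d0 := enorm_ge0 (y - xbar).
have [yr|ry] := ltP (enorm (y - xbar)) r.
  apply: le_trans (hr _ yr); rewrite leeD2lE // lee_fin gerBl.
  by rewrite mulr_ge0 ?sqr_ge0 // ltW.
case Ey : (f y) (hM y) => [b| |] // hb; last by rewrite leey.
rewrite -EFinD !lee_fin in hb *.
have tri : enorm (y - x1) ^+ 2 <= 2 * (enorm (y - xbar) ^+ 2 + enorm (xbar - x1) ^+ 2).
  have := dotvv_ge0 ((y - xbar) - (xbar - x1)).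
  have -> : y - x1 = (y - xbar) + (xbar - x1) by rewrite addrA subrK.
  rewrite !enorm_sq; move: (y - xbar) (xbar - x1) => p q.
  rewrite !(dotvDl, dotvDr, dotvNl, dotvNr); lra.
have {}tri : enorm (y - x1) ^+ 2 / (2 * lam) <=
    (enorm (y - xbar) ^+ 2 + enorm (xbar - x1) ^+ 2) / lam.
  by rewrite invfM mulrA ler_wpM2r ?(ltW i0) // ler_pdivrMr // mulrC.
have cs1 := dotv_enorm v (y - xbar).
have ca : a - M + enorm (xbar - x1) ^+ 2 / lam <= c by rewrite ler_norm.
set d := enorm (y - xbar) in d0 ry tri cs1 *.
have sd : 1 <= r^-1 * d by rewrite mulrC ler_pdivlMr // mul1r.
have e1 : enorm v * d <= enorm v * r^-1 * d ^+ 2.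
  have -> : enorm v * r^-1 * d ^+ 2 = enorm v * d * (r^-1 * d) by ring.
  by rewrite ler_peMr // mulr_ge0.
have e2 : c <= c * r^-1 ^+ 2 * d ^+ 2.
  by rewrite -mulrA -exprMn ler_peMr // exprn_ege1.
rewrite /K; lra.
Qed.

End ProxSubgradients.

(** * Existence and localization of proximal points near a critical point *)

Section ProxNearCriticalPoint.
Context {R : realType} {n : nat}.
Variables (f : 'rV[R]_n -> \bar R) (xbar v : 'rV[R]_n) (K lam : R).
Hypotheses (pf : proper_fun f) (lf : lsc f) (fx : f xbar \is a fin_num).
Hypotheses (l0 : 0 < lam) (Klam : 4 * K * lam <= 1).
Hypothesis minor : forall y,
  (f xbar + (dotv v (y - xbar) - K * enorm (y - xbar) ^+ 2)%:E <= f y)%E.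

(** Since [K] is at most half of [1 / (2 * lam)], the minorant leaves a coercive quadratic in the
    distance [d], giving [d ^+ 2 <= 4 * enorm u * d]. Only a value no worse than that of [xbar] is
    asked of [y], so the bound also confines the search for a minimizer. *)
Lemma sublevel_near_critical x u y : x = xbar + lam *: v + u ->
  (f y + (enorm (y - x) ^+ 2 / (2 * lam))%:E
     <= f xbar + (enorm (xbar - x) ^+ 2 / (2 * lam))%:E)%E ->
  enorm (y - xbar) <= 4 * enorm u /\
  (f y <= f xbar + (dotv v (y - xbar) + dotv u (y - xbar) / lam)%:E)%E.
Proof.
move=> xE; have := minor y.
have e : enorm (y - x) ^+ 2 / (2 * lam) = enorm (xbar - x) ^+ 2 / (2 * lam)
    + (enorm (y - xbar) ^+ 2 / (2 * lam)
       - (dotv v (y - xbar) + dotv u (y - xbar) / lam)).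
  have -> : xbar - x = - (lam *: v + u).
    by rewrite xE -addrA opprD addrA subrr add0r.
  have -> : y - x = (y - xbar) - (lam *: v + u).
    by rewrite xE -addrA opprD addrA.
  move: (y - xbar) => d.
  rewrite !enorm_sq !(dotvDl, dotvDr, dotvNl, dotvNr, dotvZl, dotvZr).
  rewrite (dotvC d u) (dotvC d v) (dotvC u v); field; rewrite gt_eqF //.
rewrite -(fineK fx) e; set a := fine _; case: (f y) (pf.1 y) => [b| |] // _.
rewrite -!EFinD !lee_fin; set C := _ / _ => h1 h2.
have d0 := enorm_ge0 (y - xbar); have u0 := enorm_ge0 u.
have cs := dotv_enorm u (y - xbar).
set d := enorm (y - xbar) in h1 h2 d0 cs *.
have i0 : 0 < lam^-1 by rewrite invr_gt0.
have q0 : 0 <= d ^+ 2 / (2 * lam) by rewrite divr_ge0 ?sqr_ge0 // mulr_ge0 // ltW.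
split; last lra.
have h3 : d ^+ 2 / (2 * lam) - K * d ^+ 2 <= enorm u * d / lam.
  have : dotv u (y - xbar) / lam <= enorm u * d / lam by rewrite ler_wpM2r // ltW.
  lra.
have h4 : d * (d - 4 * enorm u) <= 0.
  have : 4 * lam * (d ^+ 2 / (2 * lam) - K * d ^+ 2) <= 4 * lam * (enorm u * d / lam).
    by rewrite ler_wpM2l // mulr_ge0 // ltW.
  have -> : 4 * lam * (enorm u * d / lam) = 4 * enorm u * d by field; rewrite gt_eqF //.
  have -> : 4 * lam * (d ^+ 2 / (2 * lam) - K * d ^+ 2)
      = 2 * d ^+ 2 - 4 * K * lam * d ^+ 2 by field; rewrite gt_eqF //.
  have : 4 * K * lam * d ^+ 2 <= 1 * d ^+ 2 by rewrite ler_wpM2r // sqr_ge0.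
  rewrite expr2; lra.
have [d1|] := ltP 0 d; last lra.
by rewrite pmulr_rle0 // subr_le0 in h4.
Qed.

(** A minimizer over the closed ball of radius [4 * enorm u] is global, since points outside do
    worse than [xbar]. *)
Lemma prox_near_critical_nonempty u : prox f lam (xbar + lam *: v + u) !=set0.
Proof.
set x := _ + u; pose B := [set y : 'rV[R]_n | enorm (y - xbar) <= 4 * enorm u].
have Bx : B xbar by rewrite /B /= subrr enorm0 mulr_ge0 ?enorm_ge0.
have B0 : B !=set0 by exists xbar.
have [y By hy] :=
  lsc_compact_min (@compact_enorm_ball _ _ xbar _) B0 (lscD_sqnorm (lam := lam) (x := x) pf.1 lf).
exists y => z; have [Bz|Bz] := pselect (B z); first exact: hy.
apply: le_trans (hy _ Bx) _; apply: contrapT => /negP; rewrite -ltNge => /ltW.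
by move=> /(sublevel_near_critical erefl)[/Bz].
Qed.

Lemma prox_critical : prox f lam (xbar + lam *: v) xbar.
Proof.
have [y py] := prox_near_critical_nonempty 0; rewrite addr0 in py.
have xE : xbar + lam *: v = xbar + lam *: v + 0 by rewrite addr0.
have [] := sublevel_near_critical xE (py xbar).
rewrite enorm0 mulr0 => yx _; suff yE : y = xbar by rewrite yE in py.
apply/eqP; rewrite -subr_eq0; apply/eqP/enorm_eq0/eqP.
by rewrite eq_le yx enorm_ge0.
Qed.

Lemma prox_near_critical_localized r : 0 < r -> exists2 rho, 0 < rho &
  forall x y, enorm (x - (xbar + lam *: v)) <= rho -> prox f lam x y ->
  [/\ enorm (y - xbar) < r, enorm (lam^-1 *: (x - y) - v) < r &
      (f y < f xbar + r%:E)%E].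
Proof.
(* [C] dominates the coefficients of [rho] in the three estimates; the factor 2 in [rho] makes them
   strict, and [rho <= 1] linearizes the product of [enorm u] and [enorm (y - xbar)]. *)
move=> r0; pose C := 4 * enorm v + 5 / lam + 5.
have i0 : 0 < lam^-1 by rewrite invr_gt0.
have v0 := enorm_ge0 v.
have C0 : 0 < C by rewrite /C; lra.
pose rho := Num.min 1 (r / (2 * C)).
have rho0 : 0 < rho by rewrite lt_min ltr01 divr_gt0 ?mulr_gt0.
have rho1 : rho <= 1 by rewrite ge_min lexx.
have rhoC : rho * (2 * C) <= r by rewrite -ler_pdivlMr ?mulr_gt0 // ge_min lexx orbT.
exists rho => // x y; set u := x - _ => u1 py; have u0 := enorm_ge0 u.
have xE : x = xbar + lam *: v + u by rewrite addrC subrK.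
have [yu fy] := sublevel_near_critical xE (py xbar).
have m1 : 0 <= rho * enorm v by rewrite mulr_ge0 // ltW.
have m2 : 0 < rho * lam^-1 by rewrite mulr_gt0.
rewrite /C in rhoC; split; first lra.
- have -> : lam^-1 *: (x - y) - v = lam^-1 *: (u - (y - xbar)).
    have {1}-> : v = lam^-1 *: (lam *: v) by rewrite scalerA mulVf ?scale1r ?gt_eqF.
    rewrite -scalerBr; congr (_ *: _).
    by rewrite /u !opprD opprK; apply/rowP => i; rewrite !mxE; ring.
  rewrite enormZ gtr0_norm //.
  have : enorm (u - (y - xbar)) <= 5 * rho.
    have := enorm_triangle u (- (y - xbar)); rewrite enormN; lra.
  by move=> /(ler_wpM2l (ltW i0)); lra.
- apply: le_lt_trans fy _; rewrite lteD2lE // lte_fin.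
  have vy : dotv v (y - xbar) <= enorm v * (4 * rho).
    by apply: le_trans (dotv_enorm _ _) _; rewrite ler_wpM2l //; lra.
  have uy : dotv u (y - xbar) / lam <= 4 * rho / lam.
    rewrite ler_wpM2r ?(ltW i0) //; apply: le_trans (dotv_enorm _ _) _.
    have : enorm u * enorm (y - xbar) <= 1 * (4 * rho).
      by apply: ler_pM; rewrite ?enorm_ge0 //; lra.
    lra.
  lra.
Qed.

End ProxNearCriticalPoint.

(** * Transfer of monotonicity from the convex model to the proximal map *)

Section VariationalConvexity.
Context {R : realType} {n : nat}.
Implicit Types (f : 'rV[R]_n -> \bar R) (sigma : R).

Lemma var_convex_strongly_convex0 f xbar v :
  var_convex f xbar v -> var_convex_gen (strongly_convex_efun 0) f xbar v.
Proof.
move=> [sub [U [V [phi [eps [hU hV [lphi [cphi hphi]] e0 H]]]]]].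
split => //; exists U, V, phi, eps; split => //; split => //; split => //.
exact: convex_strongly_convex0.
Qed.

(** A single radius [r] replaces both neighborhoods and the gap [eps]; the pair [(xbar, v)] itself
    lies in the common graph, so [phi] touches [f] at [xbar]. *)
Lemma var_convex_local sigma f xbar v : 0 <= sigma ->
  var_convex_gen (strongly_convex_efun sigma) f xbar v ->
  exists phi r, [/\ 0 < r, strong_subgrad sigma phi xbar v, phi xbar = f xbar,
    forall x, enorm (x - xbar) < r -> (phi x <= f x)%E &
    forall x w, enorm (x - xbar) < r -> enorm (w - v) < r ->
      (f x < f xbar + r%:E)%E -> lim_subdiff f x w -> strong_subgrad sigma phi x w].
Proof.
move=> s0 [sub [U [V [phi [eps [[nU _] [nV _] [_ [cphi hphi]] e0 H]]]]]].
have [r1 r10 hU] := (nbhs_enormP _ _).1 nU.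
have [r2 r20 hV] := (nbhs_enormP _ _).1 nV.
have fe : (f xbar < f xbar + eps%:E)%E.
  by rewrite lteDl ?lte_fin //; case: sub.
have [Ux Vv] := (nbhs_singleton nU, nbhs_singleton nV).
have [[h1 _] h2] := H xbar v Vv.
exists phi, (Num.min r1 (Num.min r2 eps)); split.
- by rewrite !lt_min r10 r20 e0.
- by have [] := h1 (conj Ux (conj fe sub)) => _; exact: lim_strong_subgrad.
- by rewrite h2.
- by move=> x; rewrite lt_min => /andP[/hU/hphi].
move=> x w; rewrite !lt_min => /andP[/hU Ux' _] /and3P[_ /hV Vw _] fxe sx.
have [[+ _] _] := H x w Vw; case.
  split => //; split => //; apply: lt_le_trans fxe _.
  by rewrite leeD2l // lee_fin !ge_min lexx !orbT.
by move=> _; exact: lim_strong_subgrad.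
Qed.

Lemma var_convex_affine_minorant f xbar v : var_convex f xbar v ->
  exists2 r, 0 < r & forall y, enorm (y - xbar) < r ->
    (f xbar + (dotv v (y - xbar))%:E <= f y)%E.
Proof.
move=> /var_convex_strongly_convex0 /(var_convex_local (lexx 0)).
move=> [phi [r [r0 [_ sx] phix phif _]]]; exists r => // y yr.
apply: le_trans (phif _ yr); rewrite -phix; apply: le_trans (sx y).
by rewrite !mul0r addr0.
Qed.

(** Both proximal points carry subgradients of the same [phi], whose monotonicity is rescaled by
    [lam]. Equal inputs give uniqueness, [sigma = 0] gives firm nonexpansiveness, and [sigma > 0]
    gives a contraction. *)
Lemma prox_strongly_monotone sigma f xbar v K lam : 0 <= sigma ->
  proper_fun f -> lsc f -> var_convex_gen (strongly_convex_efun sigma) f xbar v ->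
  0 < lam -> 4 * K * lam <= 1 ->
  (forall y, (f xbar + (dotv v (y - xbar) - K * enorm (y - xbar) ^+ 2)%:E <= f y)%E) ->
  exists2 rho, 0 < rho & forall x1 x2 y1 y2,
    enorm (x1 - (xbar + lam *: v)) <= rho -> enorm (x2 - (xbar + lam *: v)) <= rho ->
    prox f lam x1 y1 -> prox f lam x2 y2 ->
    (1 + lam * sigma) * enorm (y1 - y2) ^+ 2 <= dotv (x1 - x2) (y1 - y2).
Proof.
move=> s0 pf lf vc l0 Kl minor; have fx := vc.1.1.
have [phi [r [r0 _ _ _ hr]]] := var_convex_local s0 vc.
have [rho rho0 hrho] := prox_near_critical_localized pf fx l0 Kl minor r0.
have sub x y : enorm (x - (xbar + lam *: v)) <= rho -> prox f lam x y ->
    strong_subgrad sigma phi y (lam^-1 *: (x - y)).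
  move=> xr py; have [yr wr fy] := hrho _ _ xr py.
  by apply: hr => //; apply: (prox_subdiff_lim_subdiff l0); exact: prox_prox_subdiff.
exists rho => // x1 x2 y1 y2 x1r x2r p1 p2.
have := strong_subgrad_monotone (sub _ _ x1r p1) (sub _ _ x2r p2).
rewrite -scalerBr dotvZl => /(ler_wpM2l (ltW l0)).
rewrite (mulrA lam lam^-1) divff ?gt_eqF // mul1r !enorm_sq.
have -> : x1 - y1 - (x2 - y2) = (x1 - x2) - (y1 - y2).
  by apply/rowP => i; rewrite !mxE; ring.
by rewrite [dotv (_ - (y1 - y2)) _]dotvDl dotvNl; lra.
Qed.

End VariationalConvexity.

(** * Averaged maps and convergence of their iterates *)

Section AveragedIteration.
Context {R : realType} {n : nat}.
Implicit Types (T : 'rV[R]_n -> 'rV[R]_n) (d D : 'rV[R]_n).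

(** Here [d], [D], [e] stand for the differences of the points, of their gradients and of their
    images. Cocoercivity gives [lam * dotv D D <= dotv D d]; the claim then follows from four times
    the firm nonexpansiveness and the square of [2 * lam *: D - d + e]. *)
Lemma forward_backward_averaged (L lam : R) d D (e : 'rV[R]_n) :
  0 < L -> 0 < lam -> 2 * L * lam <= 1 ->
  dotv D D <= 2 * L * dotv D d ->
  dotv e e <= dotv (d - lam *: D) e ->
  dotv e e <= dotv d d - dotv (d - e) (d - e) / 2.
Proof.
move=> L0 l0 Ll coc fne; have DD := dotvv_ge0 D.
have Dd0 : 0 <= dotv D d.
  by have := le_trans DD coc; rewrite pmulr_rge0 // mulr_gt0.
have Dd : lam * dotv D D <= dotv D d.
  have := ler_wpM2l (ltW l0) coc; have := ler_wpM2r Dd0 Ll; lra.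
have {}Dd := ler_wpM2l (ltW l0) Dd.
have := dotvv_ge0 (lam *: D - (d - lam *: D - e)); move: fne.
rewrite !(dotvDl, dotvDr, dotvNl, dotvNr, dotvZl, dotvZr).
rewrite (dotvC e D) (dotvC e d) (dotvC d D); lra.
Qed.

(** The factor 1/2 in the hypothesis is [(1 - alpha) / alpha] for [alpha = 2 / 3], and [N] is
    obtained by solving the averaging identity. *)
Lemma averaged_on_2_3 (U : set 'rV[R]_n) T :
  (forall x y, U x -> U y -> dotv (T x - T y) (T x - T y) <=
     dotv (x - y) (x - y) - dotv (x - y - (T x - T y)) (x - y - (T x - T y)) / 2) ->
  averaged_on U T.
Proof.
move=> hT; exists (2 / 3), (fun x => x + (3 / 2) *: (T x - x)).
split; first by apply/andP; split; lra.
  move=> x y Ux Uy; rewrite -(@ler_pXn2r _ 2) ?nnegrE ?enorm_ge0 // !enorm_sq.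
  have -> : x + (3 / 2) *: (T x - x) - (y + (3 / 2) *: (T y - y)) =
      (x - y) - (3 / 2) *: (x - y - (T x - T y)).
    by apply/rowP => i; rewrite !mxE; ring.
  have := hT _ _ Ux Uy; move: (x - y) (T x - T y) => d e.
  rewrite !(dotvDl, dotvDr, dotvNl, dotvNr, dotvZl, dotvZr) (dotvC e d); lra.
by move=> x _; apply/rowP => i; rewrite !mxE; lra.
Qed.

(* Krasnoselskii-Mann: a cluster point is a fixed point, hence the distance to it decreases. *)
Lemma averaged_iter_cvg T xbar (r : R) : let U := [set x | enorm (x - xbar) <= r] in
  (forall x y, U x -> U y -> dotv (T x - T y) (T x - T y) <=
     dotv (x - y) (x - y) - dotv (x - y - (T x - T y)) (x - y - (T x - T y)) / 2) ->
  T xbar = xbar -> forall x1, U x1 ->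
  exists xs, [/\ U xs, iter_seq T x1 @ \oo --> xs & T xs = xs].
Proof.
move=> U hT Tx x1 Ux1; pose u := iter_seq T x1.
have ne x y : U x -> U y -> enorm (T x - T y) <= enorm (x - y).
  move=> Ux Uy; rewrite -(@ler_pXn2r _ 2) ?nnegrE ?enorm_ge0 // !enorm_sq.
  apply: le_trans (hT _ _ Ux Uy) _; rewrite gerBl divr_ge0 //; exact: dotvv_ge0.
have r0 : 0 <= r by apply: le_trans Ux1; exact: enorm_ge0.
have Ux : U xbar by rewrite /U /= subrr enorm0.
have Uu k : U (u k).
  elim: k => //= k IH; have := ne _ _ IH Ux; rewrite Tx => h; exact: le_trans h IH.
pose a k := dotv (u k - xbar) (u k - xbar).
have aS k : a k.+1 <= a k - dotv (u k - u k.+1) (u k - u k.+1) / 2.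
  have := hT _ _ (Uu k) Ux; rewrite Tx.
  have -> // : u k - xbar - (T (u k) - xbar) = u k - u k.+1.
  by apply/rowP => i; rewrite /u /= !mxE; ring.
(* Asymptotic regularity: the squared distances [a k] decrease and converge, so their decrements,
   which bound half the squared steps, tend to zero. *)
have res e : 0 < e -> \forall k \near \oo, enorm (u k - u k.+1) < e.
  move=> e0.
  have ca : cvgn a.
    apply: nonincreasing_is_cvgn.
      apply/nonincreasing_seqP => k; apply: le_trans (aS k) _.
      by rewrite gerBl divr_ge0 ?dotvv_ge0.
    by exists 0 => _ [k _ <-]; exact: dotvv_ge0.
  have : (fun k => a k - a k.+1) @ \oo --> lim (a @ \oo) - lim (a @ \oo).
    by apply: cvgB => //; rewrite cvg_shiftS.
  rewrite subrr => /cvgr_lt h; have e2 : 0 < e ^+ 2 / 2 by rewrite divr_gt0 ?exprn_gt0.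
  near=> k; have : a k - a k.+1 < e ^+ 2 / 2 by near: k; exact: h.
  move=> ak; rewrite -(@ltr_pXn2r _ 2) ?nnegrE ?enorm_ge0 ?(ltW e0) // enorm_sq.
  by have := aS k; lra.
have [p [Up Cp]] : U `&` cluster (u @ \oo) !=set0.
  by apply: (@compact_enorm_ball _ _ xbar r); exists 0%N => // k _; exact: Uu.
have freq e (P : nat -> Prop) : 0 < e -> (\forall k \near \oo, P k) ->
    exists2 k, P k & enorm (u k - p) < e.
  move=> e0 PP.
  have [] := Cp (u @` P) [set y | enorm (y - p) < e].
  - by apply: filterS PP => k Pk; exists k.
  - by apply/nbhs_enormP; exists e.
  by move=> _ [[k Pk <-] /= ke]; exists k.
(* At an index where [u k] is near [p] and the step is small, nonexpansiveness makes [T p - p] a sum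
   of three terms below [e / 3]. *)
have Tp : T p = p.
  apply/eqP; rewrite -subr_eq0; apply/eqP/enorm_eq0/eqP; rewrite eq_le enorm_ge0 andbT.
  apply/ler_addgt0Pr => e e0; have e3 : 0 < e / 3 by lra.
  have [k k1 k2] := freq (e / 3) _ e3 (res _ e3).
  have h1 := ne _ _ Up (Uu k).
  have -> : T p - p = (T p - T (u k)) + ((u k - p) - (u k - u k.+1)).
    by apply/rowP => i; rewrite /u /= !mxE; ring.
  have := enorm_triangle (T p - T (u k)) ((u k - p) - (u k - u k.+1)).
  have := enorm_triangle (u k - p) (- (u k - u k.+1)).
  rewrite enormN; rewrite (enormB p) in h1; lra.
exists p; split => //; apply/cvg_enormP => e e0.
have [N _ hN] := freq e _ e0 filterT.
exists N => // k /= Nk; rewrite -(subnK Nk).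
elim: (k - N)%N => //= j IH; apply: le_lt_trans IH.
by have := ne _ _ (Uu (j + N)%N) Up; rewrite Tp.
Unshelve. all: by end_near. Qed.

Lemma geometric_iter_cvg (u : nat -> 'rV[R]_n) xbar (q : R) : 0 <= q < 1 ->
  (forall k, enorm (u k.+1 - xbar) <= q * enorm (u k - xbar)) -> u @ \oo --> xbar.
Proof.
move=> /andP[q0 q1] hu; apply/cvg_enormP => e e0.
have h k : enorm (u k - xbar) <= q ^+ k * enorm (u 0%N - xbar).
  elim: k => [|k IH]; first by rewrite mul1r.
  apply: le_trans (hu k) _; rewrite exprS -mulrA; exact: ler_wpM2l.
have cq : (fun k => q ^+ k * enorm (u 0%N - xbar)) @ \oo --> (0 : R).
  rewrite -[X in _ --> X](mul0r (enorm (u 0%N - xbar))).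
  by apply: cvgM; [apply: cvg_expr; rewrite ger0_norm|exact: cvg_cst].
near=> k; apply: le_lt_trans (h k) _; near: k.
exact: (cvgr_lt _ cq).
Unshelve. all: by end_near. Qed.

End AveragedIteration.

(** * Local minimality and the forward-backward iteration *)

Theorem mainTheorem4 (R : realType) (n : nat)
  (f : 'rV[R]_n -> \bar R) (g : 'rV[R]_n -> R) (G : 'rV[R]_n -> 'rV[R]_n)
  (xbar : 'rV[R]_n) :
  proper_fun f -> lsc f -> prox_bounded f ->
  convex_rfun g -> is_gradient g G -> lipschitz_map G ->
  var_convex f xbar (- G xbar) ->
  (exists U, nbhs xbar U /\
     forall x, U x -> (f xbar + (g xbar)%:E <= f x + (g x)%:E)%E) /\
  exists lbar : R, 0 < lbar /\ (lbar%:E <= prox_threshold f)%E /\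
  forall lam : R, 0 < lam < lbar ->
  exists (U : set 'rV[R]_n) (T : 'rV[R]_n -> 'rV[R]_n),
    [/\ nbhs xbar U,
        (* (i) T = P_lam f o (Id - lam grad g) is single-valued on U, maps U into U,
           is averaged on U and fixes xbar *)
        (forall x, U x -> prox f lam (x - lam *: G x) = [set T x] /\ U (T x)),
        averaged_on U T /\ T xbar = xbar,
        (* (ii) *)
        (forall x1, U x1 -> exists xs, [/\ U xs, iter_seq T x1 @ \oo --> xs &
                                          prox_subdiff lam f xs (- G xs)]) &
        (* (iii) *)
        (var_strongly_convex f xbar (- G xbar) ->
           exists U', [/\ nbhs xbar U', U' `<=` U &
             forall x1, U' x1 -> iter_seq T x1 @ \oo --> xbar /\
                                 converges_linearly (iter_seq T x1) xbar])].
Proof.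
move=> pf lf [lam1 [lam10 [x1 env]]] cg dg [L' [L'0 lipG']] vc.
pose L := L' + 1; have L0 : 0 < L by rewrite ltr_wpDl.
have lipG x y : enorm (G x - G y) <= L * enorm (x - y).
  by apply: le_trans (lipG' x y) _; rewrite ler_wpM2r ?enorm_ge0 // lerDl.
have coc := gradient_cocoercive cg dg L0 lipG.
have fx : f xbar \is a fin_num := vc.1.1.
have [r0 r00 aff] := var_convex_affine_minorant vc.
split.
  (* The affine minorant of [f] has slope [- G xbar], which cancels the slope of the gradient
     inequality for [g]. *)
  exists [set x | enorm (x - xbar) < r0]; split; first by apply/nbhs_enormP; exists r0.
  move=> x /aff; have := gradient_ineq cg dg xbar x.
  rewrite -(fineK fx) dotvNl; case: (f x) => [c| |] //=.
  - by rewrite -!EFinD !lee_fin; lra.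
  - by move=> _ _; rewrite addye // leey.
have [K K0 minor] := quadratic_minorant lam10 env fx r00 aff.
(* The bounds ensure, in order, [lbar] below the prox threshold, [4 * K * lam <= 1] for
   localization, and [2 * L * lam <= 1] for the gradient step. *)
pose lbar := Num.min lam1 (Num.min (4 * K)^-1 (2 * L)^-1).
exists lbar; split; first by rewrite !lt_min lam10 !invr_gt0 !mulr_gt0.
split.
  apply: (@le_trans _ _ lam1%:E); first by rewrite lee_fin ge_min lexx.
  by apply: ereal_sup_ubound; exists lam1 => //; split => //; exists x1.
move=> lam /andP[l0]; rewrite !lt_min => /and3P[_ lK lL].
have Kl : 4 * K * lam <= 1.
  by rewrite mulrC -ler_pdivlMr ?mulr_gt0 // mul1r ltW.
have Ll : 2 * L * lam <= 1.
  by rewrite mulrC -ler_pdivlMr ?mulr_gt0 // mul1r ltW.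
pose v := - G xbar; pose S x := x - lam *: G x.
(* The default [xbar] is never returned: [pT] shows that the proximal set is nonempty at every
   [S x]. *)
pose T x := xget xbar (prox f lam (S x)).
have Sd x y : S x - S y = (x - y) - lam *: (G x - G y).
  by apply/rowP => i; rewrite !mxE; ring.
have Sxb : S xbar = xbar + lam *: v by rewrite /S /v scalerN.
(* The gradient step does not increase the distance to [xbar], so a ball around [xbar] lands in the
   ball of equal radius where [mono] applies. *)
have Sne x : enorm (S x - (xbar + lam *: v)) <= enorm (x - xbar).
  rewrite -Sxb -(@ler_pXn2r _ 2) ?nnegrE ?enorm_ge0 // !enorm_sq Sd.
  have DD := dotvv_ge0 (G x - G xbar); have C := coc x xbar.
  have Dd0 : 0 <= dotv (G x - G xbar) (x - xbar).
    by have := le_trans DD C; rewrite pmulr_rge0 // mulr_gt0.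
  have := ler_wpM2r Dd0 Ll; have := ler_wpM2l (ltW l0) C.
  move: DD C Dd0; move: (x - xbar) (G x - G xbar) => d D DD C Dd0 h1 h2.
  have : lam * (lam * dotv D D) <= lam * dotv D d by rewrite ler_wpM2l ?(ltW l0) //; lra.
  have : 0 <= lam * dotv D d by rewrite mulr_ge0 // ltW.
  rewrite !(dotvDl, dotvDr, dotvNl, dotvNr, dotvZl, dotvZr) (dotvC d D); lra.
have pT x : prox f lam (S x) (T x).
  apply: xgetPex; have -> : S x = xbar + lam *: v + (S x - (xbar + lam *: v)).
    by rewrite [RHS]addrC subrK.
  exact: (prox_near_critical_nonempty pf lf fx l0 Kl minor).
have [rho rho0 mono] :=
  prox_strongly_monotone (lexx 0) pf lf (var_convex_strongly_convex0 vc) l0 Kl minor.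
pose U : set 'rV[R]_n := [set x | enorm (x - xbar) <= rho].
have Ux : U xbar by rewrite /U /= subrr enorm0 ltW.
have SU x : U x -> enorm (S x - (xbar + lam *: v)) <= rho by exact: le_trans.
have uniq x y : U x -> prox f lam (S x) y -> y = T x.
  move=> Ux0 py; have := mono _ _ _ _ (SU _ Ux0) (SU _ Ux0) py (pT x).
  rewrite mulr0 addr0 mul1r subrr dotv0l => h.
  apply/eqP; rewrite -subr_eq0; apply/eqP/dotvv_eq0.
  by apply/eqP; rewrite eq_le dotvv_ge0 -enorm_sq h.
have Txb : T xbar = xbar.
  by apply/esym; apply: uniq => //; rewrite Sxb; exact: (prox_critical pf lf fx l0 Kl minor).
have hT x y : U x -> U y -> dotv (T x - T y) (T x - T y) <=
    dotv (x - y) (x - y) - dotv (x - y - (T x - T y)) (x - y - (T x - T y)) / 2.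
  move=> Ux0 Uy; apply: (forward_backward_averaged L0 l0 Ll (coc x y)).
  have := mono _ _ _ _ (SU _ Ux0) (SU _ Uy) (pT x) (pT y).
  by rewrite mulr0 addr0 mul1r Sd enorm_sq.
exists U, T; split.
- exact: nbhs_enorm_ball.
- move=> x Ux0; split.
    apply/seteqP; split => [y py|y ->] /=; [exact: uniq | exact: pT].
  have := hT _ _ Ux0 Ux; rewrite Txb -!enorm_sq => h.
  apply: le_trans Ux0; rewrite -(@ler_pXn2r _ 2) ?nnegrE ?enorm_ge0 //.
  by apply: le_trans h _; rewrite gerBl divr_ge0 // sqr_ge0.
- by split => //; exact: averaged_on_2_3.
- move=> z Uz; have [xs [Uxs cs Txs]] := averaged_iter_cvg hT Txb Uz.
  exists xs; split => //; have := prox_prox_subdiff pf l0 (pT xs).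
  have -> : S xs - T xs = - (lam *: G xs) by rewrite Txs /S addrAC subrr add0r.
  by rewrite Txs -scalerN scalerA mulVf ?gt_eqF // scale1r.
move=> [sigma [s0 svc]].
have [rho' rho'0 mono'] := prox_strongly_monotone (ltW s0) pf lf svc l0 Kl minor.
pose q := (1 + lam * sigma)^-1.
have ls0 : 0 < lam * sigma by rewrite mulr_gt0.
have q01 : 0 <= q < 1.
  by rewrite invr_ge0 invf_lt1 ?addr_gt0 // ltrDl ls0 andbT ltW ?addr_gt0.
(* Strong convexity may come with another model [phi], hence another radius [rho']; the minimum
   keeps [U'] inside [U]. *)
pose U' : set 'rV[R]_n := [set x | enorm (x - xbar) <= Num.min rho rho'].
have contr x : U' x -> enorm (T x - xbar) <= q * enorm (x - xbar).
  rewrite /U' /= le_min => /andP[Ux0 Ux'].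
  have := mono' _ _ _ _ (le_trans (Sne x) Ux') _ (pT x) (pT xbar).
  rewrite Txb Sxb => /(_ _)/wrap[]; first by rewrite subrr enorm0 ltW.
  move=> h; rewrite /q mulrC ler_pdivlMr ?addr_gt0 //.
  (* Cauchy-Schwarz and [Sne] bound the inner product, after which one factor [enorm (T x - xbar)]
     is cancelled unless it vanishes. *)
  have := le_trans h (le_trans (dotv_enorm _ _) (ler_wpM2r (enorm_ge0 _) (Sne x))).
  have := enorm_ge0 (T x - xbar); rewrite le_eqVlt => /predU1P[<-|t0].
    by rewrite mul0r enorm_ge0.
  by rewrite expr2 mulrA ler_pM2r // mulrC.
exists U'; split.
- by apply: nbhs_enorm_ball; rewrite lt_min rho0.
- by move=> x; rewrite /U' /= le_min => /andP[].
move=> z Uz; have Uk k : U' (iter_seq T z k).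
  elim: k => //= k IH; apply: le_trans (contr _ IH) _; apply: le_trans IH.
  by rewrite ler_piMl ?enorm_ge0 //; case/andP: q01 => _ /ltW.
have lin k : enorm (iter_seq T z k.+1 - xbar) <= q * enorm (iter_seq T z k - xbar).
  exact: contr.
by split; [exact: geometric_iter_cvg lin | exists q].
Qed.
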